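(* Let $(Y;S)$ be a finite semigroup representation with $|Y|>2$. Then $(Y;S)$ is a faithful primitive representation if and only if $(Y;S^Y)$ is equivalent to a representation $(V_{\theta_P};T)$, where 1. $T$ is a subsemigroup of $\Omega(L((X;G);P))$; 2. $J((X;G);P)\subseteq T$; 3. $(X;G)$ is a primitive faithful group representation; 4. $P$ is a regular, reductive c-ramified matrix over $(X;G)$; 5. the graph $Gr(P)$ is connected. Moreover, $J((X;G);P)$ is the set of minimal functions of $(V_{\theta_P};T)$, and for all $s\neq t\in T$ there exist $j,k\in J((X;G);P)$ such that $sj\neq tj$ and $ks\neq kt$.
   Context: All sets and semigroups are finite. $T_Y$ is the semigroup of all transformations of $Y$ and $S_Y$ the group of permutations of $Y$. Representations. A representation $(Y;U)=(Y;U;\gamma)$ of a subset $U$ of a semigroup is a map $\gamma:U\to T_Y$ with $\gamma(st)=\gamma(s)\gamma(t)$ whenever $s,t,st\in U$; write $u(y)$ for $\gamma(u)(y)$. It is a semigroup representation if $U$ is a semigroup, and a group representation if $U=G$ is a group and $\gamma$ is a homomorphism into $S_Y$. It is faithful if $\gamma$ is injective. It is primitive if the only equivalence relations $\theta$ on $Y$ with $(u(a),u(b))\in\theta$ for all $(a,b)\in\theta$, $u\in U$, are the diagonal and universal relations. $(Y;U^Y)$ denotes the expansion of $(Y;U)$ by constants: the acting elements are those of $U$ (elements of $U$ acting as the same transformation are not merged) together with the full set of constant transformations of $Y$ (a constant already represented by an element of $U$ is not added again). Two representations $(Y;U)$, $(Z;W)$ are equivalent if there are bijections $\beta:Y\to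 Z$ and $\beta:U\to W$ with $\beta(u(y))=\beta(u)(\beta(y))$ for all $u\in U$, $y\in Y$, and $\beta(uv)=\beta(u)\beta(v)$ whenever $u,v,uv\in U$. For a semigroup $S$ of transformations of $Y$, $\Omega(S)=\{f\in T_Y: fS\cup Sf\subseteq S\}$. For a representation $(Y;S)$, a minimal set is a set $W=s(Y)$, $s\in S$, with $|W|\ge 2$, minimal under inclusion among the sets $s'(Y)$ ($s'\in S$) of size at least $2$; $s\in S$ is a minimal function if $s(Y)$ is a minimal set. c-ramified matrices. Let $(X;G)$ be a group representation. A c-ramified $m\times n$ matrix $P$ over $(X;G)$ has entries $P(\lambda,i)\in X\cup G$, $\lambda\in\Lambda=\{1,\dots,m\}$, $i\in I=\{1,\dots,n\}$; entries are viewed as functions on $X$ (elements of $X$ as constant functions, elements of $G$ as permutations), and products of entries are compositions. $P$ is regular if every row and every column contains an entry from $G$. Two distinct rows $\alpha,\beta$ are proportional if there is $g\in G$ with $gP(\alpha,i)=P(\beta,i)$ for all $i\in I$; two distinct columns $r,s$ are proportional if there is $h\in G$ with $P(\lambda,r)h=P(\lambda,s)$ for all $\lambda\in\Lambda$. $P$ is reductive if it has no two distinct proportional rows and no two distinct proportional columns. $J((X;G);P)$ is the set of $n\times m$ matrices having exactly one non-zero entry, that entry being in $G$; $[r,g,\lambda]$ denotes the matrix with entry $g$ in position $(r,\lambda)$. $V$ is the set of $n$-vectors with exactly one non-zero entry, that entry being in $X$; $i_x$ denotes the vector with entry $x\in X$ in row $i$. $J((X;G);P)$ acts on $V$ by $M(v)=MPv$,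 i.e. $[r,g,\lambda](i_x)=r_{gP(\lambda,i)(x)}$. Put $\theta_P=\{(r_x,s_y)\in V^2:\ P(\lambda,r)(x)=P(\lambda,s)(y)\ \text{for all }\lambda\in\Lambda\}$, an equivalence relation, and $V_{\theta_P}=V/\theta_P$; the action of $J((X;G);P)$ descends to $V_{\theta_P}$. $L((X;G);P)$ is the semigroup of transformations of $V_{\theta_P}$ consisting of those induced by $J((X;G);P)$ together with all constant transformations of $V_{\theta_P}$; elements of $J((X;G);P)$ are identified with the transformations they induce. $Gr(P)$ is the graph whose vertices are the columns $1,\dots,n$ of $P$, with distinct $r,s$ adjacent iff there exist $x,y\in X$ with $P(\lambda,r)(x)=P(\lambda,s)(y)$ for all $\lambda\in\Lambda$. *)

(* Defs.v *)
From mathcomp Require Import all_boot fingroup perm matrix.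

Set Implicit Arguments.
Unset Strict Implicit.
Unset Printing Implicit Defensive.

Local Open Scope group_scope.
Local Open Scope quotient_scope.

Notation transf Y := {ffun Y -> Y}.

Definition tcomp (Y : finType) (f g : transf Y) : transf Y :=
  [ffun y => f (g y)].

Notation "f \oo g" := (tcomp f g) (at level 50, left associativity).

Section Transf.
Variable Y : finType.

Definition tconst (c : Y) : transf Y := [ffun=> c].

Definition timage (f : transf Y) : {set Y} := [set f y | y : Y].

Definition Omega (S : {set transf Y}) : {set transf Y} :=
  [set f | [forall s in S, (f \oo s \in S) && (s \oo f \in S)]].

End Transf.

(* A representation of a subset U of a semigroup only sees the partial product  *)
(* of U: [pmul u v w] stands for "uv lies in U and uv = w".                     *)
Record representation (Y : finType) := Representation {
  elt : finType;
  pmul : elt -> elt -> elt -> bool;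
  act : elt -> transf Y;
  actM : forall u v w, pmul u v w -> act w = act u \oo act v
}.

Section Representations.
Variable Y : finType.
Implicit Type R : representation Y.

Definition faithful R : Prop := injective (@act Y R).

Definition primitive R : Prop :=
  forall e : rel Y, equivalence_rel e ->
    (forall (u : elt R) a b, e a b -> e (act u a) (act u b)) ->
  (forall a b, e a b = (a == b)) \/ (forall a b, e a b).

Definition semigroup_rep (S : finType) (mul : S -> S -> S)
    (gamma : S -> transf Y)
    (gammaM : {morph gamma : s t / mul s t >-> s \oo t}) : representation Y :=
  @Representation Y S (fun s t r => mul s t == r) gamma
    (fun s t r e => etrans (congr1 gamma (esym (eqP e))) (gammaM s t)).

Definition set_rep (T : {set transf Y}) : representation Y :=
  @Representation Y {f | f \in T} (fun s t r => val s \oo val t == val r) val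
    (fun s t r e => esym (eqP e)).

(* The expansion by constants: only the constants that are not yet represented  *)
(* are added, and nothing in U is merged.  A product in which an added constant *)
(* takes part is evaluated in T_Y; thus s times the constant y is the constant  *)
(* s(y), whether the latter is an added constant or an element of U.            *)
Section Expansion.
Variable R : representation Y.

Definition exp_elt : finType :=
  (elt R + {y : Y | tconst y \notin codom (@act Y R)})%type.

Definition exp_act (u : exp_elt) : transf Y :=
  match u with inl s => act s | inr y => tconst (val y) end.

Definition exp_prod (u v w : exp_elt) : bool :=
  match u, v, w with
  | inl s, inl t, inl r => pmul s t r
  | _, _, _ => exp_act w == exp_act u \oo exp_act v
  end.

Fact exp_actM u v w : exp_prod u v w -> exp_act w = exp_act u \oo exp_act v.
Proof.
by case: u v w => [s|y] [t|z] [r|x] ; first [exact: actM | by move/eqP].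
Qed.

Definition expansion : representation Y := Representation exp_actM.

End Expansion.

Definition minimal_set R (W : {set Y}) : bool :=
  minset (fun W' : {set Y} =>
            (1 < #|W'|)%N && [exists s : elt R, timage (act s) == W']) W.

Definition minimal_function R (s : elt R) : bool :=
  minimal_set R (timage (act s)).

Definition minimal_functions (T : {set transf Y}) : {set transf Y} :=
  [set val t | t : {f | f \in T} & @minimal_function (set_rep T) t].

End Representations.

Definition equivalent (Y Z : finType)
    (R : representation Y) (Q : representation Z) : Prop :=
  exists (b : Y -> Z) (bU : elt R -> elt Q),
    [/\ bijective b, bijective bU,
        forall (u : elt R) (y : Y), b (act u y) = act (bU u) (b y)
      & forall u v w : elt R, pmul u v w -> pmul (bU u) (bU v) (bU w)].

(* Products in {perm X} are applied from left to right, so a left action is not *)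
(* a morphism to {perm X} in the sense of the library.                          *)
Record group_representation (X : finType) (G : finGroupType) :=
  GroupRepresentation {
    gact : G -> {perm X};
    gactM : forall g h x, gact (g * h) x = gact g (gact h x)
  }.

Section GroupRep.
Variables (X : finType) (G : finGroupType) (rho : group_representation X G).

Definition gtransf (g : G) : transf X := [ffun x => gact rho g x].

Fact gtransfM g h k : g * h == k -> gtransf k = gtransf g \oo gtransf h.
Proof.
by move/eqP <-; apply/ffunP => x; rewrite !ffunE gactM.
Qed.

Definition group_rep : representation X := Representation gtransfM.

End GroupRep.

Section Ramified.
Variables (X : finType) (G : finGroupType) (rho : group_representation X G).

Definition entry_fun (e : X + G) : transf X :=
  match e with inl x => tconst x | inr g => gtransf rho g end.

Definition in_group (e : X + G) : bool := if e is inr _ then true else false.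

Variables (m n : nat) (P : 'M[(X + G)%type]_(m, n)).

Definition regular : Prop :=
  (forall lam : 'I_m, exists i : 'I_n, in_group (P lam i)) /\
  (forall i : 'I_n, exists lam : 'I_m, in_group (P lam i)).

Definition proportional_rows (a b : 'I_m) : Prop :=
  exists g : G, forall i : 'I_n,
    gtransf rho g \oo entry_fun (P a i) = entry_fun (P b i).

Definition proportional_cols (r s : 'I_n) : Prop :=
  exists h : G, forall lam : 'I_m,
    entry_fun (P lam r) \oo gtransf rho h = entry_fun (P lam s).

Definition reductive : Prop :=
  (forall a b : 'I_m, a != b -> ~ proportional_rows a b) /\
  (forall r s : 'I_n, r != s -> ~ proportional_cols r s).

(* The vector i_x is the pair (i, x). *)
Definition V : finType := ('I_n * X)%type.

Definition theta : rel V := fun v w =>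
  [forall lam : 'I_m,
     entry_fun (P lam v.1) v.2 == entry_fun (P lam w.1) w.2].

Fact theta_refl : reflexive theta.
Proof. by move=> v; apply/forallP. Qed.

Fact theta_sym : symmetric theta.
Proof. by move=> v w; apply: eq_forallb => lam; rewrite eq_sym. Qed.

Fact theta_trans : transitive theta.
Proof.
move=> v u w /forallP uv /forallP vw; apply/forallP => lam.
by rewrite (eqP (uv lam)).
Qed.

Canonical theta_equiv := EquivRel theta theta_refl theta_sym theta_trans.

(* [quot_type] is the alias of {eq_quot _} that carries the finType structure.  *)
Definition Vtheta : finType := quot_type {eq_quot theta_equiv}.

Definition cls (v : V) : Vtheta := \pi_{eq_quot theta_equiv} v.

Definition rep (q : Vtheta) : V := generic_quotient.repr (q : {eq_quot theta_equiv}).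

Lemma repK q : cls (rep q) = q.
Proof. exact: reprK. Qed.

Lemma clsP v w : reflect (cls v = cls w) (theta v w).
Proof. exact: (@eqmodP V theta_equiv v w). Qed.

(* The matrix [r, g, lam] is the triple (r, g, lam). *)
Definition Jelt : finType := ('I_n * G * 'I_m)%type.

Definition Jact (M : Jelt) (v : V) : V :=
  let: (r, g, lam) := M in (r, gact rho g (entry_fun (P lam v.1) v.2)).

Definition Jtransf (M : Jelt) : transf Vtheta :=
  [ffun q => cls (Jact M (rep q))].

Lemma Jact_theta M v w : theta v w -> Jact M v = Jact M w.
Proof. by case: M => [[r g] lam] /forallP/(_ lam)/eqP /= ->. Qed.

Lemma Jtransf_cls M v : Jtransf M (cls v) = cls (Jact M v).
Proof. by rewrite ffunE (@Jact_theta M _ v) //; apply/clsP; rewrite repK. Qed.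

Definition J : {set transf Vtheta} := [set Jtransf M | M : Jelt].

Definition L : {set transf Vtheta} := J :|: [set tconst q | q : Vtheta].

Definition Gr : rel 'I_n := fun r s =>
  (r != s) && [exists x : X, [exists y : X, theta (r, x) (s, y)]].

Record ramified_semigroup (T : {set transf Vtheta}) : Prop :=
  RamifiedSemigroup {
    ramified_Omega : T \subset Omega L;
    ramified_mul : {in T &, forall s t, s \oo t \in T};
    ramified_J : J \subset T;
    ramified_primitive : primitive (group_rep rho);
    ramified_faithful : faithful (group_rep rho);
    ramified_regular : regular;
    ramified_reductive : reductive;
    ramified_connected : forall r s : 'I_n, connect Gr r s
  }.

End Ramified.

(* Main.v *)
(** A non-constant s of minimal rank has image X, and minimality makes the maps
    X -> Y and Y -> X induced by S ("charts" and "projections") rigid: a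
    projection after a chart is either constant or a permutation of X, and
    these permutations form the group G.  Applied to suitable congruences,
    primitivity shows that projections separate the points of Y, that G is
    primitive, and that the images of the charts cover Y and are linked by
    overlaps.  With charts q_i and projections p_lambda chosen up to G, the
    matrix P(lambda, i) = p_lambda q_i coordinatizes Y through i_x |-> q_i(x).
    Conversely, in a ramified semigroup the rows of P separate the points of
    V/theta, while regularity, primitivity of G and connectedness of Gr(P)
    propagate any non-trivial congruence to everything. *)
Require Import Defs.
From mathcomp Require Import all_boot fingroup perm matrix.

Set Implicit Arguments.
Unset Strict Implicit.
Unset Printing Implicit Defensive.

Local Open Scope group_scope.

(** * Preliminaries: equivalence relations, non-constant maps, group actions *)

Lemma equivalence_rel_sym (A : Type) (e : rel A) :
  equivalence_rel e -> symmetric e.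
Proof.
move=> eE x y; apply/idP/idP => exy.
  by rewrite -((eE x y x).2 exy) (eE x x x).1.
by rewrite -((eE y x y).2 exy) (eE y y y).1.
Qed.

Lemma equivalence_relI (A : Type) (e : rel A) :
  reflexive e -> symmetric e -> transitive e -> equivalence_rel e.
Proof.
by move=> er es et; apply/equivalence_relP; split=> //; apply: sym_left_transitive.
Qed.

Section Nonconst.
Variables (A : finType) (B : eqType).
Implicit Type f : A -> B.

Definition nonconst f := [exists x, exists y, f x != f y].

Lemma nonconstP f : reflect (exists x y, f x != f y) (nonconst f).
Proof.
apply: (iffP existsP) => [[x /existsP[y ne]]|[x [y ne]]]; first by exists x, y.
by exists x; apply/existsP; exists y.
Qed.

Lemma constP f x y : ~~ nonconst f -> f x = f y.
Proof. by move=> nf; apply: contraNeq nf => ne; apply/nonconstP; exists x, y. Qed.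

End Nonconst.

Lemma tcompE (Y : finType) (f g : transf Y) y : (f \oo g) y = f (g y).
Proof. by rewrite ffunE. Qed.

Lemma timage_gt1 (Y : finType) (f : transf Y) : (1 < #|timage f|)%N = nonconst f.
Proof.
apply/card_gt1P/nonconstP => [[_ [_ [/imsetP[x _ ->] /imsetP[y _ ->] ne]]]|].
  by exists x, y.
by move=> [x [y ne]]; exists (f x), (f y); rewrite !imset_f.
Qed.

Lemma nonconst_tconst (Y : finType) (c : Y) : ~~ nonconst (tconst c).
Proof. by apply/nonconstP => -[x [y]]; rewrite !ffunE eqxx. Qed.

Lemma minimal_functionsP (Y : finType) (T : {set transf Y}) f :
  reflect (f \in T /\ minimal_set (set_rep T) (timage f)) (f \in minimal_functions T).
Proof.
apply: (iffP imsetP) => [[t + ->]|[fT fmin]].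
  by rewrite inE; split; first exact: valP.
by exists (exist (fun f => f \in T) f fT); rewrite ?inE.
Qed.

Section GroupRepresentation.
Variables (X : finType) (G : finGroupType) (rho : group_representation X G).

Lemma gact1 x : gact rho 1 x = x.
Proof. by apply: (@perm_inj _ (gact rho 1)); rewrite -gactM mulg1. Qed.

Lemma gactK g : cancel (gact rho g) (gact rho g^-1).
Proof. by move=> x; rewrite -gactM mulVg gact1. Qed.

Lemma gactKV g : cancel (gact rho g^-1) (gact rho g).
Proof. by move=> x; rewrite -gactM mulgV gact1. Qed.

End GroupRepresentation.

(** * From the matrix to the semigroup: primitivity, minimal sets, separation by J *)

Section RamifiedSemigroup.
Variables (X : finType) (G : finGroupType) (rho : group_representation X G).
Variables (m n : nat) (P : 'M[(X + G)%type]_(m, n)).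
Variable T : {set transf (Vtheta rho P)}.
Hypothesis RT : ramified_semigroup T.

Local Notation cls := (cls rho P).
Local Notation Jt := (Jtransf rho P).
Local Notation pv lam v := (entry_fun rho (P lam v.1) v.2).

Lemma cls_eqP v w : cls v = cls w <-> forall lam, pv lam v = pv lam w.
Proof.
split=> [/clsP/forallP vw lam|vw]; first exact/eqP/vw.
by apply/clsP/forallP => lam; rewrite vw.
Qed.

Lemma Jt_cls r g lam v : Jt (r, g, lam) (cls v) = cls (r, gact rho g (pv lam v)).
Proof. by rewrite Jtransf_cls. Qed.

Lemma cls_surj u : exists i x, u = cls (i, x).
Proof. by exists (rep u).1, (rep u).2; rewrite -surjective_pairing repK. Qed.

(** By regularity column [i] has an entry in G, and this single coordinate already recovers the
    point of X. *)
Lemma cls_row_inj i : injective (fun x => cls (i, x)).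
Proof.
move=> x y /cls_eqP; have [_ /(_ i)[lam]] := ramified_regular RT.
by case E: (P lam i) => [//|g] _ /(_ lam); rewrite E /= !ffunE => /perm_inj.
Qed.

(** Taking for [g] the inverse of a group entry of column [r] cancels that entry. This gives an
    idempotent of J with image [block r]. *)
Lemma Jt_row_id r : exists lam g, forall x, Jt (r, g, lam) (cls (r, x)) = cls (r, x).
Proof.
have [_ /(_ r)[lam]] := ramified_regular RT.
case E: (P lam r) => [//|g] _; exists lam, g^-1 => x.
by rewrite Jt_cls /= E /= ffunE gactK.
Qed.

Lemma Jt_onto r g lam x : exists u, Jt (r, g, lam) u = cls (r, x).
Proof.
have [/(_ lam)[i] + _] := ramified_regular RT.
case E: (P lam i) => [//|h] _; exists (cls (i, gact rho h^-1 (gact rho g^-1 x))).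
by rewrite Jt_cls /= E /= ffunE !gactKV.
Qed.

(** The blocks are the images of the members of J; they will turn out to be the minimal sets. *)
Definition block r := [set cls (r, x) | x : X].

Lemma card_block r : #|block r| = #|X|.
Proof. by rewrite card_imset //; apply: cls_row_inj. Qed.

Lemma timage_Jt r g lam : timage (Jt (r, g, lam)) = block r.
Proof.
apply/setP => u; apply/imsetP/imsetP => [[v _ ->]|[x _ ->]].
  by have [i [x ->]] := cls_surj v; rewrite Jt_cls; eexists.
by have [v <-] := Jt_onto r g lam x; exists v.
Qed.

(** Distinct classes differ in some coordinate [lam], and [[r, g, lam]] copies this coordinate,
    moved by [g], into block [r], where X embeds injectively. *)
Lemma cls_sep u v : u != v ->
  exists lam, forall r g, Jt (r, g, lam) u != Jt (r, g, lam) v.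
Proof.
have [[i [x ->]] [j [y ->]]] := (cls_surj u, cls_surj v) => ne.
have [/existsP[lam nelam]|/existsPn all_eq] :=
  boolP [exists lam, pv lam (i, x) != pv lam (j, y)].
  exists lam => r g; apply: contraNneq nelam.
  by rewrite !Jt_cls => /cls_row_inj/perm_inj ->.
by case/eqP: ne; apply/cls_eqP => lam; apply/eqP; rewrite -[_ == _]negbK all_eq.
Qed.

(** An edge of Gr(P) is a common point of two blocks, so a relation that is universal on each block
    spreads along paths. *)
Lemma connected_rel (e : rel (Vtheta rho P)) : equivalence_rel e ->
  (forall r x y, e (cls (r, x)) (cls (r, y))) -> forall u v, e u v.
Proof.
move=> eE er.
have et a b c : e a b -> e b c -> e a c by move=> /(eE a b c).2 ->.
have key p r x s y : path (Gr rho P) r p -> s = last r p ->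
    e (cls (r, x)) (cls (s, y)).
  elim: p r x => [|k p IHp] r x /= => [_ ->|]; first exact: er.
  case/andP=> /andP[_ /existsP[x1 /existsP[y1 /clsP xy1]]] pk sE.
  by apply: et (er r x x1) _; rewrite xy1; apply: IHp.
move=> u v; have [[r [x ->]] [s [y ->]]] := (cls_surj u, cls_surj v).
by have /connectP[p rp sE] := ramified_connected RT r s; apply: key rp sE.
Qed.

(** If [f] were constant on every block, its kernel would be universal by [connected_rel]. *)
Lemma nonconst_row (B : eqType) (f : Vtheta rho P -> B) :
  nonconst f -> exists r, nonconst (fun x => f (cls (r, x))).
Proof.
case/nonconstP=> u [v ne].
have [/existsP//|/existsPn no_r] := boolP [exists r, nonconst (fun x => f (cls (r, x)))].
pose e : rel (Vtheta rho P) := fun u v => f u == f v.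
have eE : equivalence_rel e by move=> a b c; rewrite /e eqxx; split=> // /eqP ->.
by case/negP: ne; apply: (connected_rel eE) => r x y; apply/eqP/(constP _ _ (no_r r)).
Qed.

Lemma nonconst_Jt (f : transf (Vtheta rho P)) : nonconst f ->
  exists r g lam, nonconst (f \oo Jt (r, g, lam)).
Proof.
case/nonconst_row=> r /nonconstP[x [y ne]].
have [lam [g idr]] := Jt_row_id r; exists r, g, lam.
by apply/nonconstP; exists (cls (r, x)), (cls (r, y)); rewrite !tcompE !idr.
Qed.

Lemma nonconst_L (f : transf (Vtheta rho P)) :
  f \in L rho P -> nonconst f -> f \in J rho P.
Proof.
by case/setUP=> // /imsetP[c _ ->]; rewrite (negPf (nonconst_tconst c)).
Qed.

Lemma OmegaL f M : f \in T ->
  f \oo Jt M \in L rho P /\ Jt M \oo f \in L rho P.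
Proof.
move/(subsetP (ramified_Omega RT)); rewrite inE => /'forall_implyP/(_ (Jt M)).
by case/(_ _)/andP; first by rewrite inE imset_f.
Qed.

Lemma Jt_in_J M : Jt M \in J rho P. Proof. exact: imset_f. Qed.

Lemma Jt_in_T M : Jt M \in T.
Proof. exact/(subsetP (ramified_J RT))/Jt_in_J. Qed.

Lemma in_JP (f : transf (Vtheta rho P)) :
  f \in J rho P -> exists r g lam, f = Jt (r, g, lam).
Proof. by case/imsetP=> [[[r g] lam]] _ ->; exists r, g, lam. Qed.

(** J carries a non-trivial related pair to a non-trivial pair in any chosen block. There
    primitivity of G makes the relation universal, and connectedness of Gr(P) does the rest. *)
Lemma ramified_set_rep_primitive : primitive (set_rep T).
Proof.
move=> e eE eT.
have eJ M a b : e a b -> e (Jt M a) (Jt M b).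
  exact: (eT (exist (fun f => f \in T) _ (Jt_in_T M)) a b).
have [diag|/forallPn[a /forallPn[b]]] := boolP [forall a, forall b, e a b ==> (a == b)].
  left=> a b; apply/idP/eqP => [ab|->]; last exact: (eE b b b).1.
  by apply/eqP; move/forallP/(_ a)/forallP/(_ b)/implyP: diag; apply.
rewrite negb_imply => /andP[ab ne]; right; apply: connected_rel => // r.
have [lam /(_ r 1) sep] := cls_sep ne.
pose eX : rel X := fun x y => e (cls (r, x)) (cls (r, y)).
have eXE : equivalence_rel eX by move=> x y z; apply: eE.
have [mu [g idr]] := Jt_row_id r.
(* As [[r, g, mu]] is the identity on block [r], the element [[r, h * g, mu]] acts on it as [h]. *)
have eXG (h : G) x y : eX x y -> eX (gact rho h x) (gact rho h y).
  have hE z : cls (r, gact rho h z) = Jt (r, h * g, mu) (cls (r, z)).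
    rewrite Jt_cls gactM; congr (cls (_, gact rho h _)).
    by apply/esym/(@cls_row_inj r); have := idr z; rewrite Jt_cls.
  by rewrite /eX !hE => /eJ.
have /= [h x y|eXd|//] := ramified_primitive RT eXE; first by rewrite !ffunE => /eXG.
move/(eJ (r, 1, lam)): ab sep.
have [[i [x ->]] [j [y ->]]] := (cls_surj a, cls_surj b).
by rewrite !Jt_cls -/(eX _ _) eXd => /eqP ->; rewrite eqxx.
Qed.

Hypothesis V_gt1 : (1 < #|Vtheta rho P|)%N.

Lemma card_X_gt1 : (1 < #|X|)%N.
Proof.
case/card_gt1P: V_gt1 => u [v [_ _ /cls_sep[lam]]].
have [i [x uE]] := cls_surj u => /(_ i 1) ne.
by rewrite -(card_block i) -(timage_Jt i 1 lam) timage_gt1; apply/nonconstP; exists u, v.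
Qed.

(** Some product of [f] with a member of J is non-constant and lies in L, hence in J; its image is a
    block inside the image of [f]. *)
Lemma block_subset (f : transf (Vtheta rho P)) : f \in T -> nonconst f ->
  exists r, block r \subset timage f.
Proof.
move=> fT /nonconst_Jt[r [g [lam ncf]]].
have /in_JP[k [h [mu fE]]] := nonconst_L (OmegaL (r, g, lam) fT).1 ncf.
exists k; rewrite -(timage_Jt k h mu) -fE.
by apply/subsetP => _ /imsetP[u _ ->]; rewrite tcompE imset_f.
Qed.

(** Every non-constant image contains a block, and all blocks have the size of X, so none lies
    properly inside another. *)
Lemma minimal_setE W :
  minimal_set (set_rep T) W = [exists r, W == block r].
Proof.
have inT (f : transf _) : f \in T ->
    [exists s : elt (set_rep T), timage (act s) == timage f].
  by move=> fT; apply/existsP; exists (exist _ f fT).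
have blockT r : [exists s : elt (set_rep T), timage (act s) == block r].
  have [lam [g _]] := Jt_row_id r.
  by rewrite -(timage_Jt r g lam) inT ?Jt_in_T.
have block_sub (U : {set Vtheta rho P}) :
    (1 < #|U|)%N && [exists s : elt (set_rep T), timage (act s) == U] ->
    exists r, block r \subset U.
  case/andP=> cU /existsP[[f fT] /= /eqP UE].
  by rewrite -UE; apply: block_subset; rewrite // -timage_gt1 UE.
apply/minsetP/existsP => [[PW minW]|[r /eqP ->]].
  have [r sub] := block_sub W PW; exists r; rewrite eq_sym.
  by apply/eqP/minW; rewrite // card_block card_X_gt1 blockT.
split=> [|U PU sub]; first by rewrite card_block card_X_gt1 blockT.
have [k subk] := block_sub U PU.
apply/eqP; rewrite eqEcard sub card_block -(card_block k).
exact: subset_leq_card.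
Qed.

Lemma minimal_functionsE : minimal_functions T = J rho P.
Proof.
apply/setP => f; apply/minimal_functionsP/idP => [[fT]|fJ].
  rewrite minimal_setE => /existsP[r /eqP /= fr].
  have [lam [g idr]] := Jt_row_id r.
  (* The idempotent of block [r] fixes the image of [f], so [f] is a product with a member of J and
     lies in L. *)
  have fE : f = Jt (r, g, lam) \oo f.
    apply/ffunP => u; rewrite tcompE.
    have : f u \in block r by rewrite -fr imset_f.
    by case/imsetP=> x _ ->; rewrite idr.
  rewrite fE; apply: nonconst_L; first by case: (OmegaL (r, g, lam) fT).
  by rewrite -fE -timage_gt1 fr card_block card_X_gt1.
split; first exact: (subsetP (ramified_J RT)).
have [r [g [lam ->]]] := in_JP fJ.
by rewrite minimal_setE; apply/existsP; exists r; rewrite timage_Jt.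
Qed.

(** One element [[r, 1, lam]] serves as both [j] and [k]: [r] is the block of a point [u] where [s]
    and [t] differ, so that [u] is in its image, and row [lam] separates [s u] from [t u]. *)
Lemma J_separates (s t : transf (Vtheta rho P)) : s <> t ->
  exists j k, [/\ j \in J rho P, k \in J rho P, s \oo j <> t \oo j & k \oo s <> k \oo t].
Proof.
move=> ne; have /existsP[u neu] : [exists u, s u != t u].
  by rewrite -negb_forall; apply/negP => /forallP eqst; apply/ne/ffunP => u; apply/eqP.
have [lam /(_ (rep u).1 1) nek] := cls_sep neu.
have [v vE] := Jt_onto (rep u).1 1 lam (rep u).2.
rewrite -surjective_pairing repK in vE.
exists (Jt ((rep u).1, 1, lam)), (Jt ((rep u).1, 1, lam)); rewrite !Jt_in_J; split=> //.
  by move/ffunP/(_ v)/eqP; rewrite !tcompE vE (negPf neu).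
by move/ffunP/(_ u)/eqP; rewrite !tcompE (negPf nek).
Qed.

End RamifiedSemigroup.

(** Representatives are indexed by ordinals because they will index the rows and columns of a
    matrix. *)
Lemma class_representatives (A : finType) (D : pred A) (R : rel A) :
  equivalence_rel R ->
  exists k (p : 'I_k -> A), [/\ forall a, D (p a),
    forall x, D x -> exists a, R (p a) x & forall a b, R (p a) (p b) -> a = b].
Proof.
move=> RE; have Rs := equivalence_rel_sym RE; have Rr x := (RE x x x).1.
have Rt x y z : R x y -> R y z -> R x z by move=> /(RE x y z).2 ->.
(* For [x] in [D] the default is never reached, [x] itself being a candidate. The pick depends only
   on the class of [x]. *)
pose can x := odflt x [pick y | D y && R x y].
have canP x : D x -> D (can x) /\ R x (can x).
  by move=> Dx; rewrite /can; case: pickP => [y /andP[]|/(_ x)]; rewrite /= ?Dx ?Rr.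
have can_eq x y : D x -> D y -> R x y -> can x = can y.
  move=> Dx Dy Rxy; rewrite /can -(eq_pick (P := fun z => D z && R x z)); last first.
    by move=> z; rewrite ((RE x y z).2 Rxy).
  by case: pickP => // /(_ x); rewrite Dx Rr.
pose E := [set can x | x in D].
have inE' (a : 'I_#|E|) : exists2 x, D x & enum_val a = can x :> A.
  by have /imsetP := enum_valP (A := E) a.
exists #|E|, enum_val; split=> [a|x Dx|a b].
- by have [x Dx ->] := inE' a; case: (canP x).
- have canE : can x \in E by apply: imset_f.
  by exists (enum_rank_in canE (can x)); rewrite enum_rankK_in // Rs; case: (canP x).
have [[x Dx xE] [y Dy yE]] := (inE' a, inE' b); rewrite xE yE => Rxy.
apply: enum_val_inj; rewrite xE yE; apply: can_eq => //.
have [[_ Rx] [_ Ry]] := (canP x Dx, canP y Dy).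
by apply: Rt (Rt _ _ _ Rx Rxy) _; rewrite Rs.
Qed.

(** * Charts and projections of an image of minimal rank *)

Section MinimalRank.
Variables (Y : finType) (S : {set transf Y}).
Hypothesis SM : {in S &, forall s t, s \oo t \in S}.
Hypothesis Sprim : primitive (set_rep S).

Lemma set_primitive (e : rel Y) : equivalence_rel e ->
    (forall f a b, f \in S -> e a b -> e (f a) (f b)) ->
  (forall a b, e a b = (a == b)) \/ (forall a b, e a b).
Proof. by move=> eE eS; apply: Sprim eE _ => -[f fS] a b; apply: eS. Qed.

(** Constants preserve every equivalence relation, and on three or more points the partition into
    one point and the rest is neither diagonal nor universal. *)
Lemma exists_nonconst : (2 < #|Y|)%N -> exists2 s, s \in S & nonconst s.
Proof.
case/card_gt2P=> a [b [c [_ [ab bc ca]]]].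
have [/exists_inP//|/exists_inPn all_const] := boolP [exists s in S, nonconst s].
pose e : rel Y := fun x y => (x == a) == (y == a).
have eE : equivalence_rel e by move=> x y z; rewrite /e eqxx; split=> // /eqP ->.
case: (set_primitive eE) => [f x y /all_const fc _|diag|univ].
- by rewrite /e (constP x y fc).
- by move: (diag b c); rewrite /e (eq_sym b) (negPf ab) (negPf ca) (negPf bc).
by move: (univ a b); rewrite /e eqxx (eq_sym b) (negPf ab).
Qed.

Lemma exists_nonconst_minimal_rank : (2 < #|Y|)%N ->
  exists s, [/\ s \in S, nonconst s &
    forall t, t \in S -> nonconst t -> (#|timage s| <= #|timage t|)%N].
Proof.
case/exists_nonconst=> s0 s0S nc0.
case: (arg_minnP (P := fun t => (t \in S) && nonconst t) (fun t => #|timage t|)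
  (i0 := s0)) => [|s /andP[sS ncs] smin]; first by rewrite s0S.
by exists s; split=> // t tS nct; apply: smin; rewrite tS.
Qed.

Variable s : transf Y.
Hypotheses (sS : s \in S) (s_nonconst : nonconst s).
Hypothesis s_min : forall t, t \in S -> nonconst t -> (#|timage s| <= #|timage t|)%N.

Definition minimal_image : finType := {y | y \in timage s}.

Definition base_projection y : minimal_image :=
  exist (fun y => y \in timage s) (s y) (imset_f (fun y => s y) isT).

Local Notation X := minimal_image.
Implicit Types (f : transf Y) (q : {ffun X -> Y}) (p : {ffun Y -> X}) (h : {perm X}).

(** Charts will give the columns of P and projections the rows. That the inclusion of X in Y is a
    chart is not immediate, as S need not contain the identity; see [val_chart]. *)
Definition chart (q : {ffun X -> Y}) :=
  nonconst q && [exists f : transf Y in S, forall x, f (val x) == q x].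

Definition projection (p : {ffun Y -> X}) :=
  nonconst p && ([ffun y => val (p y)] \in S).

(** This is the future group G; that it contains 1 depends on primitivity. *)
Definition trace_perms : {set {perm X}} :=
  [set h | [exists f : transf Y in S, forall x, f (val x) == val ((h : {perm X}) x)]].

Lemma chartP q :
  reflect (nonconst q /\ exists2 f, f \in S & forall x, f (val x) = q x) (chart q).
Proof.
apply: (iffP andP) => [[ncq /exists_inP[f fS /forallP fq]]|[ncq [f fS fq]]]; split=> //.
  by exists f => // x; apply/eqP.
by apply/exists_inP; exists f => //; apply/forallP => x; rewrite fq.
Qed.

Lemma trace_permsP (h : {perm X}) :
  reflect (exists2 f, f \in S & forall x, f (val x) = val (h x)) (h \in trace_perms).
Proof.
rewrite inE; apply: (iffP exists_inP) => [[f fS /forallP fq]|[f fS fq]].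
  by exists f => // x; apply/eqP.
by exists f => //; apply/forallP => x; rewrite fq.
Qed.

Lemma base_projection_onto x : exists y, base_projection y = x.
Proof.
by case/imsetP: (valP x) => y _ xE; exists y; apply: val_inj; rewrite xE.
Qed.

Lemma comp_chart f q : f \in S -> chart q -> nonconst (fun x => f (q x)) ->
  chart [ffun x => f (q x)].
Proof.
move=> fS /chartP[_ [g gS gq]] /nonconstP[x [y ne]]; apply/chartP; split.
  by apply/nonconstP; exists x, y; rewrite !ffunE.
by exists (f \oo g); [apply: SM | move=> z; rewrite !ffunE gq].
Qed.

Lemma comp_projection f p : f \in S -> projection p -> nonconst (fun y => p (f y)) ->
  projection [ffun y => p (f y)].
Proof.
move=> fS /andP[_ pS] /nonconstP[x [y ne]]; apply/andP; split.
  by apply/nonconstP; exists x, y; rewrite !ffunE.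
have -> : [ffun y => val ([ffun y => p (f y)] y)] = [ffun y => val (p y)] \oo f.
  by apply/ffunP => z; rewrite !ffunE.
exact: SM.
Qed.

(** If [f] in S induces [q], then [f \oo s] is non-constant with the same image as [q], so
    minimality of the rank of [s] forces this image to be as large as X. *)
Lemma chart_inj q : chart q -> injective q.
Proof.
case/chartP=> /nonconstP[x [x' ne]] [f fS fq].
have fsq y : (f \oo s) y = q (base_projection y) by rewrite tcompE -fq.
have nc : nonconst (f \oo s).
  have [[y yE] [y' yE']] := (base_projection_onto x, base_projection_onto x').
  by apply/nonconstP; exists y, y'; rewrite !fsq yE yE'.
have := s_min (SM fS sS) nc.
have -> : timage (f \oo s) = [set q x | x : X].
  apply/setP => z; apply/imsetP/imsetP => [[y _ ->]|[t _ ->]].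
    by exists (base_projection y); rewrite ?fsq.
  by have [y <-] := base_projection_onto t; exists y; rewrite ?fsq.
move=> le; have /imset_injP qinj : #|[set q x | x : X]| == #|X|.
  by rewrite eqn_leq leq_imset_card (leq_trans _ le) // card_sig.
by move=> a b; apply: qinj.
Qed.

(** Followed by the inclusion, a non-constant composite is again a chart, hence injective on the
    finite set X. *)
Lemma projection_chart_perm p q : projection p -> chart q ->
    nonconst (fun x => p (q x)) ->
  exists2 h : {perm X}, h \in trace_perms & forall x, p (q x) = h x.
Proof.
case/andP=> _ pS qA ncpq.
have rA : chart [ffun x => [ffun y => val (p y)] (q x)].
  apply: comp_chart => //; case/nonconstP: ncpq => x [y ne].
  by apply/nonconstP; exists x, y; rewrite !ffunE.
have pq_inj : injective (fun x => p (q x)).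
  by move=> x y /= pqE; apply: (chart_inj rA); rewrite !ffunE pqE.
exists (perm pq_inj) => [|x]; last by rewrite permE.
case/chartP: rA => _ [f fS fE]; apply/trace_permsP; exists f => // x.
by rewrite fE !ffunE permE.
Qed.

Lemma trace_chart (h : {perm X}) q :
  h \in trace_perms -> chart q -> chart [ffun x => q (h x)].
Proof.
case/trace_permsP=> f fS fh /chartP[/nonconstP[x [y ne]] [g gS gq]]; apply/chartP; split.
  by apply/nonconstP; exists (h^-1 x), (h^-1 y); rewrite !ffunE !permKV.
by exists (g \oo f); [apply: SM | move=> z; rewrite !ffunE fh gq].
Qed.

Lemma trace_projection (h : {perm X}) p :
  h \in trace_perms -> projection p -> projection [ffun y => h (p y)].
Proof.
case/trace_permsP=> f fS fh /andP[/nonconstP[x [y ne]] pS]; apply/andP; split.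
  by apply/nonconstP; exists x, y; rewrite !ffunE (inj_eq perm_inj).
have -> : [ffun y => val ([ffun y => h (p y)] y)] = f \oo [ffun y => val (p y)].
  by apply/ffunP => z; rewrite !ffunE fh.
exact: SM.
Qed.

Lemma projection_base : projection (finfun base_projection).
Proof.
apply/andP; split.
  case/nonconstP: s_nonconst => x [y ne]; apply/nonconstP; exists x, y.
  by rewrite !ffunE -(inj_eq val_inj).
by have -> : [ffun y => val (finfun base_projection y)] = s by apply/ffunP => y; rewrite !ffunE.
Qed.

Lemma minimal_image_pair : exists x y : X, x != y.
Proof.
case/nonconstP: s_nonconst => x [y ne]; exists (base_projection x), (base_projection y).
by rewrite -(inj_eq val_inj).
Qed.

(** Being inseparable by projections is an invariant equivalence relation, since a projection after
    an element of S is a projection or constant. It is not universal because the base projection is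
    not constant. *)
Lemma projection_separates a b :
  (forall p : {ffun Y -> X}, projection p -> p a = p b) -> a = b.
Proof.
pose e : rel Y := fun a b => [forall p : {ffun Y -> X}, projection p ==> (p a == p b)].
have eP c d : reflect (forall p : {ffun Y -> X}, projection p -> p c = p d) (e c d).
  by apply: (iffP 'forall_implyP) => h p /h /eqP.
have eE : equivalence_rel e.
  apply: equivalence_relI => [c|c d|d c c'].
  - exact/eP.
  - by apply: eq_forallb => p; rewrite eq_sym.
  by move=> /eP cd /eP dc'; apply/eP => p pB; rewrite cd ?dc'.
have [f c d fS /eP cd|diag|univ] := set_primitive eE.
- apply/eP => p pB; have [nc|cst] := boolP (nonconst (fun y => p (f y))).
    by have := cd _ (comp_projection fS pB nc); rewrite !ffunE.
  exact: constP cst.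
- by move=> /eP; rewrite diag => /eqP.
case/andP: projection_base => /nonconstP[c [d]]; have /eP/(_ _ projection_base) -> := univ c d.
by rewrite eqxx.
Qed.

Lemma trace_permsM : {in trace_perms &, forall g h, g * h \in trace_perms}.
Proof.
move=> g h /trace_permsP[f fS fg] /trace_permsP[k kS kh]; apply/trace_permsP.
exists (k \oo f); first exact: SM.
by move=> x; rewrite tcompE fg kh permM.
Qed.

(* If a projection [p] separates two points of X, then [p \o val] is a permutation *)
(* of X, and some power of it is the identity. *)
Lemma trace_perms1 : 1 \in trace_perms.
Proof.
have [x [y ne]] := minimal_image_pair.
have [p pB nep] : exists2 p : {ffun Y -> X}, projection p & p (val x) != p (val y).
  apply/exists_inP; apply: contraNT ne => /exists_inPn all_eq.
  by apply/eqP/val_inj/projection_separates => p /all_eq; rewrite negbK => /eqP.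
case/andP: (pB) => _ pS.
have rA : chart [ffun x => val (p (val x))].
  apply/chartP; split.
    by apply/nonconstP; exists x, y; rewrite !ffunE (inj_eq val_inj).
  by exists [ffun y => val (p y)] => // z; rewrite !ffunE.
have h_inj : injective (fun x : X => p (val x)).
  by move=> a b abE; apply: (chart_inj rA); rewrite !ffunE abE.
have hS : perm h_inj \in trace_perms.
  by apply/trace_permsP; exists [ffun y => val (p y)] => // z; rewrite ffunE permE.
(* Only positive powers are products of elements at hand; the order of the permutation is a positive
   exponent. *)
suff hX k : perm h_inj ^+ k.+1 \in trace_perms.
  by rewrite -(expg_order (perm h_inj)) -(prednK (order_gt0 _)) hX.
by elim: k => [|k IHk]; rewrite ?expg1 // expgS trace_permsM.
Qed.

Lemma trace_perms_group_set : group_set trace_perms.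
Proof. by apply/group_setP; split; [exact: trace_perms1 | exact: trace_permsM]. Qed.

Canonical trace_group := Group trace_perms_group_set.

Lemma val_chart : chart [ffun x => val x].
Proof.
have [f fS f1] := trace_permsP _ trace_perms1; apply/chartP; split.
  have [x [y ne]] := minimal_image_pair.
  by apply/nonconstP; exists x, y; rewrite !ffunE (inj_eq val_inj).
by exists f => // x; rewrite f1 perm1 ffunE.
Qed.

(** A projection separating two points of the image of [q] induces a permutation in the group;
    composing with its inverse gives the retraction. *)
Lemma chart_retract q :
  chart q -> exists2 p : {ffun Y -> X}, projection p & forall x, p (q x) = x.
Proof.
move=> qA; have [x [y ne]] := minimal_image_pair.
have [p pB nep] : exists2 p : {ffun Y -> X}, projection p & p (q x) != p (q y).
  apply/exists_inP; apply: contraNT ne => /exists_inPn all_eq.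
  by apply/eqP/(chart_inj qA)/projection_separates => p /all_eq; rewrite negbK => /eqP.
have nc : nonconst (fun x => p (q x)) by apply/nonconstP; exists x, y.
have [h hS hE] := projection_chart_perm pB qA nc.
exists [ffun y => h^-1 (p y)]; first by rewrite trace_projection // groupV.
by move=> z; rewrite ffunE hE permK.
Qed.

(** This expresses that the images of the charts cover Y and are linked by overlaps, in the form of
    an induction principle. *)
Lemma chart_chain (e : rel Y) : equivalence_rel e ->
  (forall q x y, chart q -> e (q x) (q y)) -> forall a b, e a b.
Proof.
move=> eE eA a b; have es := equivalence_rel_sym eE.
have et x y z : e x y -> e y z -> e x z by move=> /(eE x y z).2 ->.
(* This is the largest invariant relation inside [e]. It relates all points of X, so it is not
   diagonal. *)
pose e' : rel Y := fun a b => e a b && [forall f : transf Y in S, e (f a) (f b)].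
have e'E : equivalence_rel e'.
  apply: equivalence_relI => [x|x y|y x z].
  - by rewrite /e' (eE x x x).1; apply/forall_inP => f _; apply: (eE _ _ (f x)).1.
  - by rewrite /e' es; congr (_ && _); apply: eq_forallb => f; rewrite es.
  case/andP=> xy /forall_inP fxy /andP[yz /forall_inP fyz].
  by rewrite /e' (et _ _ _ xy yz); apply/forall_inP => f fS; apply: et (fxy f fS) (fyz f fS).
have [f c d fS /andP[_ /forall_inP fcd]|diag|univ] := set_primitive e'E.
- rewrite /e' fcd //; apply/forall_inP => g gS.
  by have := fcd _ (SM gS fS); rewrite !tcompE.
- have [x [y ne]] := minimal_image_pair; case/negP: ne; rewrite -(inj_eq val_inj) -diag.
  have := eA _ x y val_chart; rewrite !ffunE /e' => -> /=; apply/forall_inP => f fS.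
  have [nc|cst] := boolP (nonconst (fun x : X => f ([ffun x => val x] x))).
    by have := eA _ x y (comp_chart fS val_chart nc); rewrite !ffunE.
  by have := constP x y cst; rewrite !ffunE => ->; apply: (eE _ _ (f _)).1.
by case/andP: (univ a b).
Qed.

(** [chart_chain] applies to the relation of being both covered or both uncovered. *)
Lemma chart_cover y : exists (q : {ffun X -> Y}) x, chart q /\ y = q x.
Proof.
pose cov y := [exists q : {ffun X -> Y}, chart q && [exists x, y == q x]].
have covP z : reflect (exists (q : {ffun X -> Y}) x, chart q /\ z = q x) (cov z).
  apply: (iffP existsP) => [[q /andP[qA /existsP[x /eqP zE]]]|[q [x [qA zE]]]].
    by exists q, x.
  by exists q; rewrite qA; apply/existsP; exists x; rewrite zE.
pose e : rel Y := fun a b => cov a == cov b.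
have eE : equivalence_rel e by move=> a b c; rewrite /e eqxx; split=> // /eqP ->.
have cA q x : chart q -> cov (q x) by move=> qA; apply/covP; exists q, x.
have [x _] := minimal_image_pair; apply/covP.
have /eqP -> : e y ([ffun x : X => val x] x).
  by apply: chart_chain => // q a b qA; rewrite /e !cA.
exact/cA/val_chart.
Qed.

(** * The group G acting on X, and charts and projections up to G *)

Definition traceG : finGroupType := subg_of trace_group.

Fact trace_gactM (g h : traceG) x :
  (sgval (g * h))^-1 x = (sgval g)^-1 ((sgval h)^-1 x).
Proof. by rewrite sgvalM ?inE // invMg permM. Qed.

(* Inverses turn the left-to-right product of permutations into a left action. *)
Definition trace_rep : group_representation X traceG := GroupRepresentation trace_gactM.

Lemma trace_gact h : h \in trace_perms -> exists g : traceG, gact trace_rep g = h.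
Proof.
move=> hS; exists (subg trace_group h^-1).
by rewrite /= subgK ?invgK // groupV.
Qed.

Lemma gact_trace (g : traceG) : gact trace_rep g \in trace_perms.
Proof. by rewrite groupV subgP. Qed.

Lemma stab_rep_faithful : faithful (group_rep trace_rep).
Proof.
move=> g h /ffunP gh; apply/val_inj/invg_inj/permP => x.
by have := gh x; rewrite !ffunE.
Qed.

(** A congruence [th] of G lifts to Y by relating points whose images under every projection are
    [th]-related. If the lift is diagonal, so is [th], because projections restrict to X as
    constants or members of G; if it is universal, a retraction onto X makes [th] universal. *)
Lemma stab_rep_primitive : primitive (group_rep trace_rep).
Proof.
move=> th thE thG; have th_sym := equivalence_rel_sym thE.
have th_refl x : th x x := (thE x x x).1.
have thH h x y : h \in trace_perms -> th x y -> th (h x) (h y).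
  by case/trace_gact=> g <- /(thG g); rewrite !ffunE.
pose e : rel Y := fun a b => [forall p : {ffun Y -> X}, projection p ==> th (p a) (p b)].
have eE : equivalence_rel e.
  apply: equivalence_relI => [a|a b|b a c].
  - by apply/'forall_implyP => p _; apply: th_refl.
  - by apply: eq_forallb => p; rewrite th_sym.
  move=> /'forall_implyP ab /'forall_implyP bc; apply/'forall_implyP => p pB.
  by rewrite ((thE _ _ (p c)).2 (ab _ pB)) bc.
have [f a b fS /'forall_implyP ab|diag|univ] := set_primitive eE.
- apply/'forall_implyP => p pB; have [nc|cst] := boolP (nonconst (fun y => p (f y))).
    by have := ab _ (comp_projection fS pB nc); rewrite !ffunE.
  by rewrite (constP a b cst).
- left=> x y; apply/idP/eqP => [xy|->//]; apply/val_inj/eqP.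
  rewrite -diag; apply/'forall_implyP => p pB.
  have [nc|cst] := boolP (nonconst (fun x : X => p ([ffun x => val x] x))).
    have [h hS hE] := projection_chart_perm pB val_chart nc.
    by have := (hE x, hE y); rewrite !ffunE => -[-> ->]; apply: thH.
  by have := constP x y cst; rewrite !ffunE => ->.
right=> x y; have [p pB pK] := chart_retract val_chart.
have := (pK x, pK y); rewrite !ffunE => -[<- <-].
by have /'forall_implyP := univ (val x) (val y); apply.
Qed.

(** Related charts would give proportional columns and related projections proportional rows, so P
    takes one representative of each class. *)
Definition chart_rel : rel {ffun X -> Y} := fun q q' =>
  [exists h in trace_perms, q' == [ffun x => q ((h : {perm X}) x)]].

Definition projection_rel : rel {ffun Y -> X} := fun p p' =>
  [exists h in trace_perms, p' == [ffun y => (h : {perm X}) (p y)]].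

Lemma chart_relP q q' :
  reflect (exists2 h : {perm X}, h \in trace_perms & forall x, q' x = q (h x)) (chart_rel q q').
Proof.
apply: (iffP exists_inP) => -[h hS qE]; exists h => //.
  by move=> x; rewrite (eqP qE) ffunE.
by apply/eqP/ffunP => x; rewrite qE ffunE.
Qed.

Lemma projection_relP p p' :
  reflect (exists2 h : {perm X}, h \in trace_perms & forall y, p' y = h (p y)) (projection_rel p p').
Proof.
apply: (iffP exists_inP) => -[h hS pE]; exists h => //.
  by move=> y; rewrite (eqP pE) ffunE.
by apply/eqP/ffunP => y; rewrite pE ffunE.
Qed.

Lemma chart_rel_equiv : equivalence_rel chart_rel.
Proof.
have sym q q' : chart_rel q q' -> chart_rel q' q.
  case/chart_relP=> h hS qE; apply/chart_relP; exists h^-1; rewrite ?groupV // => x.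
  by rewrite qE permKV.
apply: equivalence_relI => [q|q q'|q q1 q2].
- by apply/chart_relP; exists 1; rewrite ?group1 // => x; rewrite perm1.
- by apply/idP/idP; apply: sym.
move=> /chart_relP[h hS qE] /chart_relP[k kS qE']; apply/chart_relP.
exists (k * h); first exact: groupM.
by move=> x; rewrite qE' qE permM.
Qed.

Lemma projection_rel_equiv : equivalence_rel projection_rel.
Proof.
have sym p p' : projection_rel p p' -> projection_rel p' p.
  case/projection_relP=> h hS pE; apply/projection_relP; exists h^-1; rewrite ?groupV // => x.
  by rewrite pE permK.
apply: equivalence_relI => [p|p p'|p p1 p2].
- by apply/projection_relP; exists 1; rewrite ?group1 // => x; rewrite perm1.
- by apply/idP/idP; apply: sym.
move=> /projection_relP[h hS pE] /projection_relP[k kS pE']; apply/projection_relP.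
exists (h * k); first exact: groupM.
by move=> x; rewrite pE' pE permM.
Qed.

(** The dichotomy between constants and permutations in G is what makes the matrix c-ramified. *)
Lemma exists_entry p q : projection p -> chart q ->
  exists e : X + traceG, forall x, entry_fun trace_rep e x = p (q x).
Proof.
move=> pB qA; have [nc|cst] := boolP (nonconst (fun x => p (q x))).
  have [h /trace_gact[g gE] hE] := projection_chart_perm pB qA nc.
  by exists (inr g) => x; rewrite /= ffunE gE hE.
have [x0 _] := minimal_image_pair; exists (inl (p (q x0))) => x.
by rewrite /= ffunE (constP x0 x cst).
Qed.

(** * The matrix P and the coordinates it gives on Y *)

Section Coordinates.
Variables (m n : nat) (qs : 'I_n -> {ffun X -> Y}) (ps : 'I_m -> {ffun Y -> X}).
Hypotheses (qsA : forall i, chart (qs i)) (psB : forall lam, projection (ps lam)).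
Hypothesis qs_rel : forall q, chart q -> exists i, chart_rel (qs i) q.
Hypothesis ps_rel : forall p, projection p -> exists lam, projection_rel (ps lam) p.
Hypothesis qs_uniq : forall i j, chart_rel (qs i) (qs j) -> i = j.
Hypothesis ps_uniq : forall a b, projection_rel (ps a) (ps b) -> a = b.
Variable P : 'M[(X + traceG)%type]_(m, n).
Hypothesis PE : forall lam i x, entry_fun trace_rep (P lam i) x = ps lam (qs i x).

Local Notation rho := trace_rep.
Local Notation cls := (cls rho P).

Lemma ps_separate a b : (forall lam, ps lam a = ps lam b) -> a = b.
Proof.
move=> ab; apply: projection_separates => p /ps_rel[lam /projection_relP[h _ pE]].
by rewrite !pE ab.
Qed.

Definition point (u : Vtheta rho P) : Y := qs (rep u).1 (rep u).2.

(** Pairs related by [theta] have the same value under every [ps lam], and these values determine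
    the point of Y. *)
Lemma point_cls i x : point (cls (i, x)) = qs i x.
Proof.
apply: ps_separate => lam; rewrite -!PE.
by have /cls_eqP/(_ lam) := repK (cls (i, x)).
Qed.

Lemma point_inj : injective point.
Proof.
move=> u v; have [[i [x ->]] [j [y ->]]] := (cls_surj u, cls_surj v).
by rewrite !point_cls => xy; apply/cls_eqP => lam; rewrite !PE xy.
Qed.

Lemma point_surj y : exists u, point u = y.
Proof.
have [q [x [/qs_rel[i /chart_relP[h hS qE]] ->]]] := chart_cover y.
by exists (cls (i, h x)); rewrite point_cls qE.
Qed.

Lemma entry_in_groupE lam i :
  Defs.in_group (P lam i) = nonconst (fun x => ps lam (qs i x)).
Proof.
apply/idP/nonconstP => [|[x [y]]].
  have [x [y ne]] := minimal_image_pair; case E: (P lam i) => [//|g] _; exists x, y.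
  by rewrite -!PE E /= !ffunE (inj_eq perm_inj).
by rewrite -!PE; case: (P lam i) => //= z; rewrite !ffunE eqxx.
Qed.

(** A row without group entries would be constant on every chart, hence on Y by [chart_chain]. For a
    column, the row representing a retraction of its chart has a group entry. *)
Lemma coordinates_regular : regular P.
Proof.
split=> [lam|i].
  have [/existsP//|/existsPn all_const] := boolP [exists i, Defs.in_group (P lam i)].
  pose e : rel Y := fun a b => ps lam a == ps lam b.
  have eE : equivalence_rel e by move=> a b c; rewrite /e eqxx; split=> // /eqP ->.
  have univ : forall a b, e a b.
    apply: chart_chain => // q x y /qs_rel[i /chart_relP[h _ qE]].
    have := all_const i; rewrite entry_in_groupE => cst.
    by rewrite /e !qE; apply/eqP/(constP _ _ cst).
  case/andP: (psB lam) => /nonconstP[a [b]]; case/negP; exact: univ.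
have [p /ps_rel[lam /projection_relP[h _ pE]] pK] := chart_retract (qsA i).
exists lam; rewrite entry_in_groupE; have [x [y ne]] := minimal_image_pair.
apply/nonconstP; exists x, y; apply: contraNneq ne => xy.
by rewrite -(pK x) -(pK y) !pE xy.
Qed.

(** Proportionality of rows lifts to projections because charts cover Y, that of columns to charts
    because projections separate points; representatives of distinct classes exclude both. *)
Lemma coordinates_reductive : reductive rho P.
Proof.
split=> [a b|r t] /eqP ne [g gE]; apply: ne.
  apply/ps_uniq/projection_relP; exists (gact rho g) => [|y]; first exact: gact_trace.
  have [q [x [/qs_rel[i /chart_relP[h hS qE]] ->]]] := chart_cover y.
  by rewrite qE -!PE -gE !ffunE.
apply/qs_uniq/chart_relP; exists (gact rho g) => [|x]; first exact: gact_trace.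
by apply: ps_separate => lam; rewrite -!PE -gE tcompE ffunE.
Qed.

(** [chart_chain] applies to the relation between points whose columns are connected. *)
Lemma Gr_connected i j : connect (Gr rho P) i j.
Proof.
have Gr_sym : connect_sym (Gr rho P).
  apply: sym_connect_sym => k l; rewrite /Gr eq_sym; congr (_ && _).
  by apply/existsP/existsP => -[x /existsP[y xy]]; exists y; apply/existsP; exists x;
     rewrite theta_sym.
(* A point may lie on several charts; the choice is harmless, since columns sharing a point are
   equal or adjacent. *)
have [col colE] : exists col : Y -> 'I_n, forall y, exists x, y = qs (col y) x.
  apply: (fin_all_exists (P := fun y k => exists x, y = qs k x)) => y.
  have [u <-] := point_surj y; exists (rep u).1, (rep u).2; exact: erefl.
have col_qs k x : connect (Gr rho P) k (col (qs k x)).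
  have [z zE] := colE (qs k x); have [<-|ne] := eqVneq k (col (qs k x)).
    exact: connect0.
  apply: connect1; rewrite /Gr ne; apply/existsP; exists x; apply/existsP; exists z.
  by apply/clsP/point_inj; rewrite !point_cls.
pose e : rel Y := fun a b => connect (Gr rho P) (col a) (col b).
have eE : equivalence_rel e.
  apply: equivalence_relI => [a|a b|b a c]; [exact: connect0|exact: Gr_sym|exact: connect_trans].
have [x _] := minimal_image_pair.
have : e (qs i x) (qs j x).
  apply: chart_chain => // q y z /qs_rel[k /chart_relP[h _ qE]]; rewrite /e !qE.
  by apply: connect_trans (col_qs k _); rewrite Gr_sym.
rewrite /e => ij; apply: connect_trans (connect_trans (col_qs i x) ij) _.
by rewrite Gr_sym.
Qed.

(** * Transport of the semigroup from Y to V/theta *)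

Variable c : Y -> Vtheta rho P.
Hypotheses (pointK : cancel point c) (cK : cancel c point).

Definition transport (f : transf (Vtheta rho P)) : transf Y := [ffun y => point (f (c y))].

Lemma point_Jtransf r g lam u :
  point (Jtransf rho P (r, g, lam) u) = qs r (gact rho g (ps lam (point u))).
Proof.
by have [i [x ->]] := cls_surj u; rewrite Jt_cls !point_cls PE.
Qed.

Lemma transportE (f : transf (Vtheta rho P)) u : point (f u) = transport f (point u).
Proof. by rewrite ffunE pointK. Qed.

Lemma transportM (f g : transf (Vtheta rho P)) : transport (f \oo g) = transport f \oo transport g.
Proof. by apply/ffunP => y; rewrite !ffunE pointK. Qed.

Lemma transport_in_J (f : transf (Vtheta rho P)) r h lam : h \in trace_perms ->
  (forall y, transport f y = qs r (h (ps lam y))) -> f \in J rho P.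
Proof.
case/trace_gact=> g <- fE; apply/imsetP; exists (r, g, lam) => //.
by apply/ffunP => u; apply: point_inj; rewrite transportE fE point_Jtransf.
Qed.

Lemma transport_in_L (f : transf (Vtheta rho P)) : ~~ nonconst f -> f \in L rho P.
Proof.
move=> cst; have [x _] := minimal_image_pair; have [u _] := point_surj (val x).
rewrite inE; apply/orP; right; apply/imsetP; exists (f u) => //.
by apply/ffunP => v; rewrite ffunE (constP v u cst).
Qed.

Definition transported : {set transf (Vtheta rho P)} := [set f | transport f \in S].

(** On Y, [[r, g, lam]] is the projection [ps lam] followed by the chart [qs r] twisted by [g], and
    both parts come from S. *)
Lemma J_sub_transported : J rho P \subset transported.
Proof.
apply/subsetP => _ /imsetP[[[r g] lam] _ ->]; rewrite inE.
have /chartP[_ [f fS fE]] := trace_chart (gact_trace g) (qsA r).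
have /andP[_ pS] := psB lam; rewrite (_ : transport _ = f \oo [ffun y => val (ps lam y)]).
  exact: SM.
by apply/ffunP => y; rewrite tcompE [LHS]ffunE point_Jtransf cK ffunE fE ffunE.
Qed.

(** Multiplying a member of J on the left changes its chart, on the right its projection. The new
    map is constant or, up to G, a chosen representative. *)
Lemma transported_Omega : transported \subset Omega (L rho P).
Proof.
apply/subsetP => f; rewrite !inE => fS; apply/forall_inP => k.
case/setUP=> [/imsetP[[[r g] lam] _ ->]|/imsetP[u _ ->]]; last first.
  by apply/andP; split; apply/transport_in_L/nonconstP => -[v [w]]; rewrite !tcompE !ffunE eqxx.
apply/andP; split.
  have [nc|cst] := boolP (nonconst (f \oo Jtransf rho P (r, g, lam))); last exact: transport_in_L.
  have nq : nonconst (fun x => transport f (qs r x)).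
    case/nonconstP: nc => v [w]; rewrite -(inj_eq point_inj) !tcompE !(transportE f).
    by rewrite !point_Jtransf => ne; apply/nonconstP; do 2!eexists; apply: ne.
  have [i /chart_relP[h hS hE]] := qs_rel (comp_chart fS (qsA r) nq).
  rewrite inE; apply/orP; left.
  (* Permutation products run from left to right: [g] acts first, then [h]. *)
  apply: (@transport_in_J _ i (gact rho g * h) lam) => [|y]; first by rewrite groupM ?gact_trace.
  rewrite transportM tcompE [transport (Jtransf _ _ _) y]ffunE point_Jtransf cK.
  by rewrite permM -hE [RHS]ffunE.
have [nc|cst] := boolP (nonconst (Jtransf rho P (r, g, lam) \oo f)); last exact: transport_in_L.
have nq : nonconst (fun y => ps lam (transport f y)).
  case/nonconstP: nc => v [w]; rewrite -(inj_eq point_inj) !tcompE.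
  rewrite !point_Jtransf !transportE => ne; apply/nonconstP.
  by exists (point v), (point w); apply: contraNneq ne => ->.
have [mu /projection_relP[h hS hE]] := ps_rel (comp_projection fS (psB lam) nq).
rewrite inE; apply/orP; left.
apply: (@transport_in_J _ r (h * gact rho g) mu) => [|y]; first by rewrite groupM ?gact_trace.
by rewrite [LHS]ffunE tcompE point_Jtransf transportE cK permM -hE [in RHS]ffunE.
Qed.

Lemma transported_ramified : ramified_semigroup transported.
Proof.
split.
- exact: transported_Omega.
- by move=> f g; rewrite !inE transportM; apply: SM.
- exact: J_sub_transported.
- exact: stab_rep_primitive.
- exact: stab_rep_faithful.
- exact: coordinates_regular.
- exact: coordinates_reductive.
- exact: Gr_connected.
Qed.

End Coordinates.

End MinimalRank.

Lemma exists_ramified_transport (Y : finType) (S : {set transf Y}) : (2 < #|Y|)%N ->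
    {in S &, forall s t, s \oo t \in S} -> primitive (set_rep S) ->
  exists (X : finType) (G : finGroupType) (rho : group_representation X G)
      (m n : nat) (P : 'M[(X + G)%type]_(m, n))
      (b : Vtheta rho P -> Y) (c : Y -> Vtheta rho P),
    [/\ cancel b c, cancel c b &
      ramified_semigroup [set f : transf (Vtheta rho P) | [ffun y => b (f (c y))] \in S]].
Proof.
move=> Y_gt2 SM Sprim.
have [s [sS nc smin]] := exists_nonconst_minimal_rank Sprim Y_gt2.
have [n [qs [qsA qs_rel qs_uniq]]] :=
  class_representatives (@chart _ S s) (chart_rel_equiv SM Sprim sS nc smin).
have [m [ps [psB ps_rel ps_uniq]]] :=
  class_representatives (@projection _ S s) (projection_rel_equiv SM Sprim sS nc smin).
pose G := traceG SM Sprim sS nc smin; pose rho := trace_rep SM Sprim sS nc smin.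
have [e eE] : exists e : 'I_m * 'I_n -> minimal_image s + G,
    forall li x, entry_fun rho (e li) x = ps li.1 (qs li.2 x).
  apply: (fin_all_exists (P := fun li el => forall x, entry_fun rho el x = ps li.1 (qs li.2 x))).
  by move=> [lam i]; apply: exists_entry.
pose P : 'M[(minimal_image s + G)%type]_(m, n) := (\matrix_(lam, i) e (lam, i))%R.
have PE lam i x : entry_fun rho (P lam i) x = ps lam (qs i x) by rewrite mxE eE.
have [c cK] : exists c, forall y, point qs (c y : Vtheta rho P) = y.
  apply: (fin_all_exists (P := fun y u => point qs (u : Vtheta rho P) = y)).
  exact: (point_surj qs_rel ps_rel PE).
have pK : cancel (point qs (P:=P)) c.
  by move=> u; apply: (point_inj ps_rel PE); rewrite cK.
exists (minimal_image s), G, rho, m, n, P, (point qs (P:=P)), c; split=> //.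
exact: (transported_ramified qsA psB qs_rel ps_rel qs_uniq ps_uniq PE pK cK).
Qed.

(** * Invariance under equivalence, and the expansion by constants *)

Lemma equivalent_primitive (Y Z : finType) (R : representation Y) (Q : representation Z) :
  equivalent R Q -> primitive Q -> primitive R.
Proof.
case=> b [bU [[c bK cK] [cU _ cUK] b_act _]] Qprim e eE eR.
have [|u v w|diag|univ] := Qprim (fun v w => e (c v) (c w)).
- by move=> x y z; apply: eE.
- have c_act z : c (act u z) = act (cU u) (c z).
    by rewrite -(bK (act _ _)) b_act cUK cK.
  by rewrite !c_act; apply: eR.
- by left=> x y; have := diag (b x) (b y); rewrite !bK (can_eq bK).
- by right=> x y; have := univ (b x) (b y); rewrite !bK.
Qed.

Lemma equivalent_faithful (Y Z : finType) (R : representation Y) (Q : representation Z) :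
  equivalent R Q -> faithful Q -> faithful R.
Proof.
case=> b [bU [[c _ cK] /bij_inj bU_inj b_act _]] Qfaith u v uv.
apply/bU_inj/Qfaith/ffunP => z.
by rewrite -(cK z) -!b_act uv.
Qed.

Lemma set_rep_faithful (Y : finType) (T : {set transf Y}) : faithful (set_rep T).
Proof. exact: val_inj. Qed.

Section Expansion.
Variables (Y : finType) (R : representation Y).

(** An added constant never coincides with the action of an element of [R], by the way the expansion
    is formed. *)
Lemma expansion_faithfulE : faithful (expansion R) <-> faithful R.
Proof.
split=> [fR s t st|fR]; first by have [] := fR (inl s) (inl t) st.
move=> [s|[y yR]] [t|[z zR]] /= st.
- by rewrite (fR s t).
- by case/negP: zR; rewrite -st codom_f.
- by case/negP: yR; rewrite st codom_f.
congr inr; apply: val_inj => /=.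
by have /ffunP/(_ y) := st; rewrite !ffunE.
Qed.

(** Constants preserve every reflexive relation, so the congruences are the same. *)
Lemma expansion_primitiveE : primitive (expansion R) <-> primitive R.
Proof.
split=> Rprim e eE eR; apply: (Rprim e eE) => u a b ab; last exact: (eR (inl u)).
by case: u => [s|y]; [exact: eR | rewrite /= !ffunE (eE _ _ (val y)).1].
Qed.

Definition expansion_set : {set transf Y} := [set exp_act u | u : exp_elt R].

Lemma tconst_expansion_set y : tconst y \in expansion_set.
Proof.
have [/codomP[s ->]|yR] := boolP (tconst y \in codom (@act Y R)).
  by apply/imsetP; exists (inl s).
by apply/imsetP; exists (inr (exist (fun y => tconst y \notin codom (@act Y R)) y yR)).
Qed.

Lemma expansion_set_primitive : primitive R -> primitive (set_rep expansion_set).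
Proof.
move/expansion_primitiveE=> Rprim e eE eS; apply: Rprim eE _ => u a b.
exact: (eS (exist (fun f => f \in expansion_set) _ (imset_f (@exp_act Y R) (isT : u \in predT))) a b).
Qed.

End Expansion.

Lemma expansion_setM (Y S : finType) (mul : S -> S -> S) (gamma : S -> transf Y)
    (gammaM : {morph gamma : s t / mul s t >-> s \oo t}) :
  {in expansion_set (semigroup_rep gammaM) &, forall f g,
     f \oo g \in expansion_set (semigroup_rep gammaM)}.
Proof.
move=> _ _ /imsetP[[s|y] _ ->] /imsetP[[t|z] _ ->] /=.
- by rewrite -gammaM; apply/imsetP; exists (inl (mul s t)).
- suff -> : gamma s \oo tconst (val z) = tconst (gamma s (val z)) by apply: tconst_expansion_set.
  by apply/ffunP => x; rewrite !ffunE.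
- suff -> : tconst (val y) \oo gamma t = tconst (val y) by apply: tconst_expansion_set.
  by apply/ffunP => x; rewrite !ffunE.
suff -> : tconst (val y) \oo tconst (val z) = tconst (val y) by apply: tconst_expansion_set.
by apply/ffunP => x; rewrite !ffunE.
Qed.

(** Conjugation by the bijection is onto by the choice of the set, and faithfulness makes it
    injective on elements. *)
Lemma equivalent_transport (Y Z : finType) (R : representation Y) (b : Z -> Y) (c : Y -> Z) :
    cancel b c -> cancel c b -> faithful R ->
  equivalent (expansion R)
    (set_rep [set f : transf Z | [ffun y => b (f (c y))] \in expansion_set R]).
Proof.
move=> bK cK /expansion_faithfulE Rfaith; set T := [set f | _].
pose tr (f : transf Y) : transf Z := [ffun v => c (f (b v))].
have trK (f : transf Y) : [ffun y => b (tr f (c y))] = f.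
  by apply/ffunP => y; rewrite !ffunE !cK.
have trT (u : exp_elt R) : tr (exp_act u) \in T by rewrite inE trK; apply/imsetP; exists u.
pose bU u : elt (set_rep T) := exist (fun f => f \in T) _ (trT u).
exists c, bU; split.
- by exists b.
- have bU_inj : injective bU.
    move=> u v /(congr1 val) /= /(congr1 (fun g : transf Z => [ffun y => b (g (c y))])).
    by rewrite !trK => /Rfaith.
  have [bV bVK] : exists bV, forall t, bU (bV t) = t.
    apply: (fin_all_exists (P := fun t u => bU u = t)) => -[f fT].
    have := fT; rewrite inE => /imsetP[u _ fu]; exists u; apply: val_inj => /=.
    by apply/ffunP => v; rewrite -fu !ffunE !bK.
  by exists bV => // u; apply: bU_inj.
- by move=> u y; rewrite /= ffunE cK.
move=> u v w /actM uvw; apply/eqP/ffunP => z /=.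
by rewrite !ffunE cK -[exp_act w]/(act (w : elt (expansion R))) uvw ffunE.
Qed.

Theorem theorem1p8 (Y : finType) (S : finType)
    (mul : S -> S -> S) (mulA : associative mul) (gamma : S -> transf Y)
    (gammaM : {morph gamma : s t / mul s t >-> s \oo t}) (Y_gt2 : 2 < #|Y|) :
  ((faithful (semigroup_rep gammaM) /\ primitive (semigroup_rep gammaM)) <->
   (exists (X : finType) (G : finGroupType) (rho : group_representation X G)
       (m n : nat) (P : 'M[(X + G)%type]_(m, n))
       (T : {set transf (Vtheta rho P)}),
     ramified_semigroup T /\
     equivalent (expansion (semigroup_rep gammaM)) (set_rep T)))
  /\
  (forall (X : finType) (G : finGroupType) (rho : group_representation X G)
      (m n : nat) (P : 'M[(X + G)%type]_(m, n))
      (T : {set transf (Vtheta rho P)}),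
     ramified_semigroup T ->
     equivalent (expansion (semigroup_rep gammaM)) (set_rep T) ->
     J rho P = minimal_functions T /\
     (forall s t : transf (Vtheta rho P), s \in T -> t \in T -> s <> t ->
        exists j k : transf (Vtheta rho P),
          [/\ j \in J rho P, k \in J rho P,
              s \oo j <> t \oo j & k \oo s <> k \oo t])).
Proof.
(* The equivalence transfers the size of Y, which guarantees that blocks have at least two
   points. *)
have ramified_gt1 (X : finType) (G : finGroupType) (rho : group_representation X G)
    (m n : nat) (P : 'M[(X + G)%type]_(m, n)) (T : {set transf (Vtheta rho P)}) :
    equivalent (expansion (semigroup_rep gammaM)) (set_rep T) -> 1 < #|Vtheta rho P|.
  by case=> b [_ [/bij_eq_card <- _ _ _]]; apply: ltnW.
split; last first.
  move=> X G rho m n P T RT /ramified_gt1 V_gt1; split.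
    by rewrite (minimal_functionsE RT V_gt1).
  by move=> s t _ _; apply: J_separates RT _ _.
split=> [[Sfaith Sprim]|[X [G [rho [m [n [P [T [RT equ]]]]]]]]].
  (* The construction is run on the expanded semigroup, since it is the expansion that must match
     [T]. *)
  have [X [G [rho [m [n [P [b [c [bK cK RT]]]]]]]]] :=
    exists_ramified_transport Y_gt2 (expansion_setM (gammaM := gammaM)) (expansion_set_primitive Sprim).
  exists X, G, rho, m, n, P; eexists; split; first exact: RT.
  exact: equivalent_transport.
split.
  apply/expansion_faithfulE/(equivalent_faithful equ)/set_rep_faithful.
apply/expansion_primitiveE/(equivalent_primitive equ).
exact: ramified_set_rep_primitive RT.
Qed.
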